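(* Let $p$ be a prime, let $\Gamma$ be a finitely generated group and let $\Delta$ be a normal subgroup of finite index in $\Gamma$. Then $\mathrm{def}_p\,\Delta\geq(\Gamma:\Delta)\,\mathrm{def}_p\,\Gamma$. In particular, if $\mathrm{def}_p\,\Gamma$ is non-negative (respectively positive), then $\mathrm{def}_p\,\Delta$ is non-negative (respectively positive), and furthermore $\Delta$ has a non-trivial pro-$p$ completion.
   Context: $(\Gamma:\Delta)$ denotes the index. Let $F$ be the free group on a finite set $X$. For a non-trivial $w\in F$, the $p$-valuation $\nu_p(w)$ is the largest integer $k$ such that $w=v^{p^k}$ for some $v\in F$. For a presentation $\langle X|R\rangle$ with $X$ finite ($R\subseteq F$ possibly infinite) its $p$-deficiency is $\mathrm{def}_p\langle X|R\rangle=|X|-1-\sum_{r\in R}p^{-\nu_p(r)}$ (equal to $-\infty$ if the sum diverges). The $p$-deficiency $\mathrm{def}_p\,\Gamma$ of a finitely generated group $\Gamma$ is the supremum of $\mathrm{def}_p\langle X|R\rangle$ over all presentations $\langle X|R\rangle$ of $\Gamma$ with a finite generating set $X$. *)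

(* Defs.v *)
From HB Require Import structures.
From mathcomp Require Import all_boot all_order all_algebra finmap.
From mathcomp Require Import all_classical all_reals all_analysis.

Set Implicit Arguments.
Unset Strict Implicit.
Unset Printing Implicit Defensive.

Import Order.TTheory GRing.Theory Num.Theory.

Local Open Scope classical_set_scope.
Local Open Scope group_scope.

(* The free group on [X] as the set of reduced words in the letters
   [(x, true)] (standing for x) and [(x, false)] (standing for x^-1);
   [free_group_universal] below is its universal property. *)

Definition flip (X : choiceType) (a : X * bool) : X * bool := (a.1, ~~ a.2).

Definition reduced (X : choiceType) (w : seq (X * bool)) : bool :=
  sorted (fun a b => b != flip a) w.

Record free_group (X : choiceType) := FreeGroup {
  fg_word :> seq (X * bool);
  fg_reduced : reduced fg_word }.

HB.instance Definition _ (X : choiceType) := [isSub for @fg_word X].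
HB.instance Definition _ (X : choiceType) := [Choice of free_group X by <:].

(* Left multiplication of a reduced word by a letter. *)
Definition fg_cons (X : choiceType) (a : X * bool) (w : seq (X * bool)) :=
  if w is b :: w' then if b == flip a then w' else a :: w else [:: a].

Definition word_mul (X : choiceType) (u v : seq (X * bool)) :=
  foldr (@fg_cons X) v u.

Definition word_inv (X : choiceType) (u : seq (X * bool)) :=
  rev (map (@flip X) u).

Lemma flipK (X : choiceType) : involutive (@flip X).
Proof. by case=> x b; rewrite /flip /= negbK. Qed.

Lemma fg_cons_reduced (X : choiceType) (a : X * bool) w :
  reduced w -> reduced (fg_cons a w).
Proof.
case: w => [|b w] //= bw; case: ifPn => [_|nba] /=; first exact: path_sorted bw.
by rewrite nba.
Qed.

Lemma fg_consK (X : choiceType) (a : X * bool) w :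
  reduced w -> fg_cons a (fg_cons (flip a) w) = w.
Proof.
case: w => [|b w] /= bw; first by rewrite eqxx.
rewrite flipK; case: eqP => [ba|_]; last by rewrite /= eqxx.
by move: bw; rewrite ba; case: w => [|c w] //= /andP[/negPf ->].
Qed.

Lemma word_mul_reduced (X : choiceType) (u v : seq (X * bool)) :
  reduced v -> reduced (word_mul u v).
Proof. by move=> rv; elim: u => //= a u; apply: fg_cons_reduced. Qed.

Lemma word_mulw1 (X : choiceType) (u : seq (X * bool)) :
  reduced u -> word_mul u [::] = u.
Proof.
elim: u => //= a u IH au; rewrite IH; last exact: path_sorted au.
by case: u {IH} au => [|b u] //= /andP[/negPf ->].
Qed.

Lemma word_mul_cons (X : choiceType) (a : X * bool) u v : reduced v ->
  word_mul (fg_cons a u) v = fg_cons a (word_mul u v).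
Proof.
move=> rv; case: u => [|b u] //=; case: eqP => [->|_] //=.
by rewrite fg_consK ?word_mul_reduced.
Qed.

Lemma word_mulA (X : choiceType) (u v w : seq (X * bool)) : reduced w ->
  word_mul u (word_mul v w) = word_mul (word_mul u v) w.
Proof. by move=> rw; elim: u => //= a u ->; rewrite word_mul_cons. Qed.

Lemma word_invK (X : choiceType) : involutive (@word_inv X).
Proof.
by move=> u; rewrite /word_inv map_rev revK -map_comp map_id_in // => a _; exact: flipK.
Qed.

Lemma word_mulKw (X : choiceType) (u v : seq (X * bool)) : reduced v ->
  word_mul (word_inv u) (word_mul u v) = v.
Proof.
move=> rv; elim: u => //= a u IH.
rewrite /word_inv /= rev_cons /word_mul foldr_rcons -/(word_mul _ _).
by rewrite -{2}[a]flipK fg_consK ?word_mul_reduced.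
Qed.

Lemma word_inv_reduced (X : choiceType) (u : seq (X * bool)) :
  reduced u -> reduced (word_inv u).
Proof.
rewrite /reduced /word_inv rev_sorted sorted_map; apply: sub_sorted => a b.
by apply: contraNN => /eqP/= ->; rewrite flipK.
Qed.

Definition fg_one (X : choiceType) : free_group X :=
  @FreeGroup X [::] isT.
Definition fg_mul (X : choiceType) (u v : free_group X) : free_group X :=
  FreeGroup (word_mul_reduced u (fg_reduced v)).
Definition fg_inv (X : choiceType) (u : free_group X) : free_group X :=
  FreeGroup (word_inv_reduced (fg_reduced u)).

Lemma fg_mulA (X : choiceType) : associative (@fg_mul X).
Proof. by move=> u v w; apply: val_inj; apply: word_mulA (fg_reduced w). Qed.

Lemma fg_mul1 (X : choiceType) : left_id (@fg_one X) (@fg_mul X).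
Proof. by move=> u; apply: val_inj. Qed.

Lemma fg_mulr1 (X : choiceType) : right_id (@fg_one X) (@fg_mul X).
Proof. by move=> u; apply: val_inj; apply: word_mulw1 (fg_reduced u). Qed.

Lemma fg_mulV (X : choiceType) :
  left_inverse (@fg_one X) (@fg_inv X) (@fg_mul X).
Proof.
move=> u; apply: val_inj => /=; rewrite -{2}(word_mulw1 (fg_reduced u)).
exact: word_mulKw.
Qed.

Lemma fg_mulrV (X : choiceType) :
  right_inverse (@fg_one X) (@fg_inv X) (@fg_mul X).
Proof.
move=> u; rewrite -{1}[u](_ : fg_inv (fg_inv u) = u) ?fg_mulV //.
by apply: val_inj; apply: word_invK.
Qed.

HB.instance Definition _ (X : choiceType) := isGroup.Build (free_group X)
  (@fg_mulA X) (@fg_mul1 X) (@fg_mulr1 X) (@fg_mulV X) (@fg_mulrV X).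

Definition fg_gen (X : choiceType) (x : X) : free_group X :=
  @FreeGroup X [:: (x, true)] isT.

Definition letter_eval (X : choiceType) (G : groupType) (h : X -> G)
    (a : X * bool) : G := if a.2 then h a.1 else (h a.1)^-1.

Definition fg_eval (X : choiceType) (G : groupType) (h : X -> G)
    (w : free_group X) : G :=
  foldr (fun a g => letter_eval h a * g) 1 w.

Lemma letter_eval_flip (X : choiceType) (G : groupType) (h : X -> G) a :
  letter_eval h (flip a) = (letter_eval h a)^-1.
Proof. by case: a => x [] //=; rewrite /letter_eval /= ?invgK. Qed.

Lemma fg_evalM (X : choiceType) (G : groupType) (h : X -> G) :
  {morph fg_eval h : u v / u * v}.
Proof.
move=> u v; rewrite /fg_eval /=; elim: (fg_word u) => [|a s IH] /=.
  by rewrite mul1g.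
rewrite -mulgA -IH; case: (word_mul s v) => [|b t] //=.
by case: eqP => [->|//]; rewrite letter_eval_flip mulgA mulgV mul1g.
Qed.

HB.instance Definition _ (X : choiceType) (G : groupType) (h : X -> G) :=
  isMultiplicative.Build (free_group X) G (fg_eval h) (@fg_evalM X G h).

Lemma free_group_universal (X : choiceType) (G : groupType) (h : X -> G) :
  exists! f : free_group X -> G,
    {morph f : u v / u * v} /\ forall x, f (fg_gen x) = h x.
Proof.
exists (fg_eval h); split.
  by split; [exact: fg_evalM|move=> x; rewrite /fg_eval /= mulg1].
move=> f [fM fx]; apply/funext => -[w rw]; symmetry.
have f1 : f 1 = 1 by apply: (mulgI (f 1)); rewrite -fM !mulg1.
elim: w rw => [|a s IH] rw.
  by transitivity (f 1); [congr f; apply: val_inj|exact: f1].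
have rs : reduced s by exact: path_sorted rw.
have ra : reduced [:: a] by [].
have -> : FreeGroup rw = FreeGroup ra * FreeGroup rs.
  by apply: val_inj; case: s rw rs {IH} => [|b s] //= /andP[/negPf ->] _ _.
rewrite fM fg_evalM -IH; congr (_ * _); rewrite /fg_eval /= mulg1.
case: a {rw} ra => x [] ra; rewrite /letter_eval /= -fx.
  by congr f; apply: val_inj.
by apply: (mulgI (f (fg_gen x))); rewrite mulgV -fM -f1; congr f;
  apply: val_inj; rewrite /= eqxx.
Qed.

Definition is_subgroup (G : groupType) (N : set G) : Prop :=
  [/\ N 1, (forall a b, N a -> N b -> N (a * b)) &
      (forall a, N a -> N a^-1)].

Definition is_normal_subgroup (G : groupType) (N : set G) : Prop :=
  is_subgroup N /\ forall g a, N a -> N (a ^ g).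

Definition left_coset (G : groupType) (N : set G) (g : G) : set G :=
  [set g * a | a in N].

Definition left_cosets (G : groupType) (N : set G) : set (set G) :=
  range (left_coset N).

Definition finite_index (G : groupType) (N : set G) : Prop :=
  finite_set (left_cosets N).

(* Only meaningful when [finite_index N]. *)
Definition group_index (G : groupType) (N : set G) : nat :=
  #|` fset_set (left_cosets N)|.

Definition finitely_generated (G : groupType) : Prop :=
  exists s : seq G, forall N : set G,
    is_subgroup N -> [set` s] `<=` N -> N = setT.

Definition normal_closure (G : groupType) (A : set G) : set G :=
  \bigcap_(N in [set N | is_normal_subgroup N /\ A `<=` N]) N.

(* <X | A> is a presentation of G: G is the quotient of the free group on X by
   the normal closure of A. *)
Definition is_presentation (X : finType) (A : set (free_group X))
    (G : groupType) : Prop :=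
  exists f : {multiplicative free_group X -> G},
    set_surj setT setT f /\ f @^-1` [set 1] = normal_closure A.

Definition is_p_power_in (X : choiceType) (p : nat) (w : free_group X)
    (k : nat) : Prop :=
  exists v : free_group X, w = v ^+ (p ^ k)%N.

(* The largest k such that w is a p^k-th power; it exists for w <> 1 and
   1 < p. On w = 1 the value is junk, see [relator_weight]. *)
Definition p_valuation (X : choiceType) (p : nat) (w : free_group X) : nat :=
  xget 0%N [set k | is_p_power_in p w k /\
                    forall j, is_p_power_in p w j -> (j <= k)%N].

(* p^-nu_p(r). The trivial word is a p^k-th power for all k, so its valuation
   is infinite and it contributes 0. *)
Definition relator_weight (R : realType) (X : choiceType) (p : nat)
    (r : free_group X) : R :=
  if r == 1 then 0%R else (p%:R ^- p_valuation p r)%R.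

Definition presentation_deficiency (R : realType) (p : nat) (X : finType)
    (A : set (free_group X)) : \bar R :=
  ((#|X|%:R - 1)%:E - (\esum_(r in A) (relator_weight R p r)%:E)%R)%E.

Definition p_deficiency (R : realType) (p : nat) (G : groupType) : \bar R :=
  ereal_sup [set d | exists (X : finType) (A : set (free_group X)),
    is_presentation A G /\ d = presentation_deficiency R p A].

(* The normal subgroups N such that G / N is a finite p-group. *)
Definition p_power_index (p : nat) (G : groupType) (N : set G) : Prop :=
  [/\ is_normal_subgroup N, finite_index N &
      exists k, group_index N = (p ^ k)%N].

Definition p_quotients (p : nat) (G : groupType) : Type :=
  {N : set G | p_power_index p N}.

(* The inverse limit of the quotients G / N over the normal subgroups N of
   p-power index: a compatible choice of cosets. For N included in M, the
   projection G / N -> G / M sends a coset of N to the coset of M containing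
   it. The topology is left out. *)
Record pro_p_completion (p : nat) (G : groupType) := ProP {
  thread :> p_quotients p G -> set G;
  thread_coset : forall N, left_cosets (sval N) (thread N);
  thread_compat : forall N M, sval N `<=` sval M -> thread N `<=` thread M }.

HB.instance Definition _ (p : nat) (G : groupType) :=
  gen_eqMixin (pro_p_completion p G).
HB.instance Definition _ (p : nat) (G : groupType) :=
  gen_choiceMixin (pro_p_completion p G).

Lemma prop_ext (p : nat) (G : groupType) (x y : pro_p_completion p G) :
  thread x =1 thread y -> x = y.
Proof.
case: x y => [x x1 x2] [y y1 y2] /= /funext xy.
by case: _ / xy in y1 y2 *; congr ProP; exact: Prop_irrelevance.
Qed.

Definition set_mul (G : groupType) (A B : set G) : set G :=
  [set a * b | a in A & b in B].

Definition set_inv (G : groupType) (A : set G) : set G := [set a^-1 | a in A].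

Lemma set_mul_coset (G : groupType) (N : set G) g h : is_normal_subgroup N ->
  set_mul (left_coset N g) (left_coset N h) = left_coset N (g * h).
Proof.
move=> [[N1 NM NV] NJ]; rewrite /set_mul /left_coset; apply/seteqP; split.
  move=> _ [_ [a Na <-]] [_ [b Nb <-]] <-; exists (a ^ h * b).
    by apply: NM => //; exact: NJ.
  by rewrite /conjg !mulgA mulgK.
move=> _ [a Na <-]; exists g; first by exists 1; rewrite ?mulg1.
by exists (h * a); [exists a|rewrite mulgA].
Qed.

Lemma set_inv_coset (G : groupType) (N : set G) g : is_normal_subgroup N ->
  set_inv (left_coset N g) = left_coset N g^-1.
Proof.
move=> [[N1 NM NV] NJ]; rewrite /set_inv /left_coset; apply/seteqP; split.
  move=> _ [_ [a Na <-]] <-; exists (a^-1 ^ g^-1); first exact/NJ/NV.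
  by rewrite /conjg invgM invgK !mulgA mulVg mul1g.
move=> _ [a Na <-]; exists (g * a^-1 ^ g); last first.
  by rewrite /conjg !mulgA mulgV mul1g invgM invgK.
by exists (a^-1 ^ g) => //; exact/NJ/NV.
Qed.

Lemma left_coset1 (G : groupType) (N : set G) : left_coset N 1 = N.
Proof.
rewrite /left_coset; apply/seteqP; split=> [_ [a Na <-]|a Na].
  by rewrite mul1g.
by exists a; rewrite ?mul1g.
Qed.

Definition p_quotients_normal (p : nat) (G : groupType) (N : p_quotients p G) :
    is_normal_subgroup (sval N).
Proof. by case: N => N []. Qed.

Lemma prop_one_coset (p : nat) (G : groupType) (N : p_quotients p G) :
  left_cosets (sval N) (sval N).
Proof. by exists 1; rewrite ?left_coset1. Qed.

Lemma prop_mul_coset (p : nat) (G : groupType) (x y : pro_p_completion p G) N :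
  left_cosets (sval N) (set_mul (x N) (y N)).
Proof.
have [g _ <-] := thread_coset x N; have [h _ <-] := thread_coset y N.
by rewrite set_mul_coset; [exists (g * h)|exact: p_quotients_normal].
Qed.

Lemma prop_mul_compat (p : nat) (G : groupType) (x y : pro_p_completion p G)
    (N M : p_quotients p G) :
  sval N `<=` sval M -> set_mul (x N) (y N) `<=` set_mul (x M) (y M).
Proof.
move=> NM _ [a xa] [b yb] <-; exists a; first exact: thread_compat xa.
by exists b => //; exact: thread_compat yb.
Qed.

Lemma prop_inv_coset (p : nat) (G : groupType) (x : pro_p_completion p G) N :
  left_cosets (sval N) (set_inv (x N)).
Proof.
have [g _ <-] := thread_coset x N.
by rewrite set_inv_coset; [exists g^-1|exact: p_quotients_normal].
Qed.

Lemma prop_inv_compat (p : nat) (G : groupType) (x : pro_p_completion p G)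
    (N M : p_quotients p G) :
  sval N `<=` sval M -> set_inv (x N) `<=` set_inv (x M).
Proof. by move=> NM _ [a xa] <-; exists a => //; exact: thread_compat xa. Qed.

Definition prop_one (p : nat) (G : groupType) : pro_p_completion p G :=
  @ProP p G (fun N => sval N) (@prop_one_coset p G) (fun _ _ NM => NM).
Definition prop_mul (p : nat) (G : groupType) (x y : pro_p_completion p G) :=
  ProP (prop_mul_coset x y) (@prop_mul_compat p G x y).
Definition prop_inv (p : nat) (G : groupType) (x : pro_p_completion p G) :=
  ProP (prop_inv_coset x) (@prop_inv_compat p G x).

Lemma prop_mulA (p : nat) (G : groupType) : associative (@prop_mul p G).
Proof.
move=> x y z; apply: prop_ext => N /=; have nN := p_quotients_normal N.
have [a _ <-] := thread_coset x N; have [b _ <-] := thread_coset y N.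
by have [c _ <-] := thread_coset z N; rewrite !set_mul_coset // mulgA.
Qed.

Lemma prop_mul1 (p : nat) (G : groupType) :
  left_id (@prop_one p G) (@prop_mul p G).
Proof.
move=> x; apply: prop_ext => N /=; have nN := p_quotients_normal N.
have [a _ <-] := thread_coset x N.
by rewrite -{1}[sval N]left_coset1 set_mul_coset // mul1g.
Qed.

Lemma prop_mulr1 (p : nat) (G : groupType) :
  right_id (@prop_one p G) (@prop_mul p G).
Proof.
move=> x; apply: prop_ext => N /=; have nN := p_quotients_normal N.
have [a _ <-] := thread_coset x N.
by rewrite -{2}[sval N]left_coset1 set_mul_coset // mulg1.
Qed.

Lemma prop_mulV (p : nat) (G : groupType) :
  left_inverse (@prop_one p G) (@prop_inv p G) (@prop_mul p G).
Proof.
move=> x; apply: prop_ext => N /=; have nN := p_quotients_normal N.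
have [a _ <-] := thread_coset x N.
by rewrite set_inv_coset // set_mul_coset // mulVg left_coset1.
Qed.

Lemma prop_mulrV (p : nat) (G : groupType) :
  right_inverse (@prop_one p G) (@prop_inv p G) (@prop_mul p G).
Proof.
move=> x; apply: prop_ext => N /=; have nN := p_quotients_normal N.
have [a _ <-] := thread_coset x N.
by rewrite set_inv_coset // set_mul_coset // mulgV left_coset1.
Qed.

HB.instance Definition _ (p : nat) (G : groupType) :=
  isGroup.Build (pro_p_completion p G) (@prop_mulA p G) (@prop_mul1 p G)
    (@prop_mulr1 p G) (@prop_mulV p G) (@prop_mulrV p G).

Definition nontrivial (G : groupType) : Prop := exists x : G, x <> 1.

(* Main.v *)
(* Let pi : F -> Gamma be a presentation and n = (Gamma : Delta).  The
   Reidemeister-Schreier generators are all n|X| pairs (coset, letter); no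
   Schreier transversal is chosen, so freeness of pi^-1(Delta) is not needed:
   the n - 1 words rewriting the coset representatives are added as relators, of
   weight at most 1 each.  A relator r = v^(p^k) of Gamma gives relators of total
   weight at most n p^-k for Delta, because its conjugates by powers of v
   coincide.  Altogether def_p Delta >= n|X| - 1 - (n - 1) - n sum_r p^-nu_p(r).

   If def_p Delta > -1, some presentation of Delta has fewer relators of
   valuation 0 than generators.  Linear algebra over F_p then gives a nonzero
   morphism to F_p killing these relators; it kills the other ones because they
   are p-th powers.  So Delta has a normal subgroup of index p. *)

Require Import Defs.
From HB Require Import structures.
From mathcomp Require Import all_boot all_order all_algebra finmap lra.
From mathcomp Require Import all_classical all_reals all_analysis.

Set Implicit Arguments.
Unset Strict Implicit.
Unset Printing Implicit Defensive.

Import Order.TTheory GRing.Theory Num.Theory.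

Local Open Scope classical_set_scope.
Local Open Scope group_scope.

(** * Powers in free groups *)

Lemma word_mul_cat (X : choiceType) (u v : seq (X * bool)) :
  reduced (u ++ v) -> word_mul u v = u ++ v.
Proof.
elim: u => //= a u IH ruv; rewrite IH; last exact: path_sorted ruv.
by case: (u ++ v) ruv => //= b w /andP[/negPf ->].
Qed.

(** As long as the first and last letters cancel, they are moved into [u] and its inverse. The
    second conjunct says that no cancellation occurs between consecutive copies of the core
    [a :: c]. *)
Lemma cyclically_reduced_core (X : choiceType) (w : seq (X * bool)) :
  reduced w -> w != [::] ->
  exists u a c, w = u ++ (a :: c) ++ word_inv u /\ a != flip (last a c).
Proof.
have [n] := ubnP (size w); elim: n w => // n IH [//|a w] /ltnSE wn aw _.
have [awl|awl] := eqVneq a (flip (last a w)); last first.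
  by exists [::], a, w; rewrite /word_inv /= cats0.
have nfl : a != flip a by rewrite -pair_eqE /= eqxx; case: (a.2).
case/lastP: w => [|w b] in awl wn aw *; first by rewrite [X in X != _]awl eqxx in nfl.
rewrite last_rcons in awl.
have b_a : b = flip a by rewrite awl flipK.
have w0 : w != [::].
  by apply: contraTneq aw => ->; rewrite /reduced /= b_a eqxx.
have rw : reduced w.
  by move: aw; rewrite /reduced /= rcons_path => /andP[/path_sorted].
have [|u [d [c [-> dc]]]] := IH w _ rw w0.
  by move: wn; rewrite /= size_rcons => /ltnW.
exists (a :: u), d, c; split => //.
by rewrite /word_inv /= rev_cons b_a -!cats1 /= -!catA /= -catA.
Qed.

(** If [v] is [u C u^-1] with [C] cyclically reduced, then [v ^+ m] is the reduced word
    [u C^m u^-1], which contains [m] copies of [C]. *)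
Lemma leq_expg_size (X : choiceType) (v : free_group X) m :
  v != 1 -> (0 < m)%N -> (m <= size (fg_word (v ^+ m)))%N.
Proof.
move=> v1; case: m => // m _.
have [||u [a [c [vE ac]]]] := @cyclically_reduced_core X (fg_word v).
- exact: fg_reduced.
- by apply: contra v1 => /eqP v1; apply/eqP/val_inj.
have rv : reduced (u ++ (a :: c) ++ word_inv u) by rewrite -vE fg_reduced.
pose C m := flatten (nseq m (a :: c)).
(* [ac] makes the junction of two consecutive copies of the core reduced. *)
have pC k : path (fun x y => y != flip x) (last a c) (C k ++ word_inv u).
  have := rv; rewrite /reduced /= sorted_cat_cons cat_path => /and3P[_ pc pu].
  by elim: k => //= k IH; rewrite -catA cat_path ac pc.
have rC k : reduced (u ++ (a :: c) ++ C k ++ word_inv u).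
  have := rv; rewrite /reduced /= !sorted_cat_cons !(cat_path _ _ c) => /and3P[-> -> _].
  exact: pC.
suff -> : fg_word (v ^+ m.+1) = u ++ C m.+1 ++ word_inv u.
  rewrite !size_cat; apply: leq_trans (leq_addl _ _).
  apply: leq_trans (leq_addr _ _).
  rewrite /C size_flatten /shape map_nseq sumn_nseq /= mulSn.
  by rewrite addSn ltnS addnCA leq_addr.
elim: m => [|m IH]; first by rewrite expg1 /C /= cats0.
rewrite expgS [LHS]/= IH vE /word_mul !foldr_cat -!/(word_mul _ _).
have ru k : reduced (u ++ C k.+1 ++ word_inv u).
  by have := rC k; rewrite /C /= -!catA.
rewrite -(word_mul_cat (ru m)) word_mulKw; last by case/cat_sorted2: (ru m).
rewrite (@word_mul_cat _ (a :: c)); last first.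
  by case/cat_sorted2: (rC m.+1).
by rewrite word_mul_cat //; congr (u ++ _); rewrite catA.
Qed.

(** The default value 0 of [xget] does no harm: every word is the [p ^ 0]-th power of itself. *)
Lemma p_valuationP (X : choiceType) (p : nat) (w : free_group X) :
  is_p_power_in p w (p_valuation p w).
Proof.
rewrite /p_valuation; case: xgetP => [k _ []//|_].
by exists w; rewrite expn0 expg1.
Qed.

Lemma leq_p_valuation (X : choiceType) (p : nat) (w : free_group X) k :
  (1 < p)%N -> w != 1 -> is_p_power_in p w k -> (k <= p_valuation p w)%N.
Proof.
move=> p1 w1 pk; rewrite /p_valuation; case: xgetP => [j _ [_]|]; first exact.
pose P j := `[< is_p_power_in p w j >].
have exP : exists j, P j by exists k; apply/asboolP.
(* The maximum exists because [j < p ^ j] and [p ^ j] is at most the length of [w]. *)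
have leP j : P j -> (j <= size (fg_word w))%N.
  move=> /asboolP[v wE]; rewrite wE.
  have v1 : v != 1 by apply: contra_neq w1; rewrite wE => ->; rewrite expg1n.
  apply: leq_trans (leq_expg_size v1 _); last by rewrite expn_gt0 ltnW.
  by rewrite ltnW // ltn_expl.
case: (ex_maxnP exP leP) => m /asboolP Pm mP /(_ m)[]; split=> // j Pj.
by apply: mP; apply/asboolP.
Qed.

Lemma relator_weight_ge0 (R : realType) (X : choiceType) p (r : free_group X) :
  (0 <= relator_weight R p r)%R.
Proof. by rewrite /relator_weight; case: ifP => // _; rewrite invr_ge0 exprn_ge0. Qed.

Lemma relator_weight_le (R : realType) (X : choiceType) p (r : free_group X) k :
  (1 < p)%N -> is_p_power_in p r k -> (relator_weight R p r <= p%:R ^- k)%R.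
Proof.
move=> p1 rk; rewrite /relator_weight; case: eqVneq => [_|r1].
  by rewrite invr_ge0 exprn_ge0.
have p0 : (0 < p%:R :> R)%R by rewrite ltr0n ltnW.
rewrite lef_pV2 ?posrE ?exprn_gt0 // ler_weXn2l ?leq_p_valuation //.
by rewrite ler1n ltnW.
Qed.

(** * Morphisms on free groups and normal closures *)

Lemma free_group_ind (X : choiceType) (N : set (free_group X)) :
  is_subgroup N -> (forall x, N (fg_gen x)) -> N = setT.
Proof.
move=> [N1 NM NV] Nx; apply/seteqP; split=> // -[w rw] _.
elim: w rw => [|a s IH] rw.
  by rewrite (_ : FreeGroup rw = 1) //; apply: val_inj.
have rs : reduced s by exact: path_sorted rw.
have ra : reduced [:: a] by [].
have -> : FreeGroup rw = FreeGroup ra * FreeGroup rs.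
  by apply: val_inj; case: s rw rs {IH} => [|b s] //= /andP[/negPf ->] _ _.
apply: NM (IH rs); case: a {rw} ra => x [] ra.
  by rewrite (_ : FreeGroup ra = fg_gen x) //; apply: val_inj.
rewrite (_ : FreeGroup ra = (fg_gen x)^-1); first exact: NV.
exact: val_inj.
Qed.

Lemma fg_eval_gen (X : choiceType) (G : groupType) (h : X -> G) x :
  fg_eval h (fg_gen x) = h x.
Proof. by rewrite /fg_eval /= mulg1. Qed.

Lemma multiplicative1 (G H : groupType) (f : {multiplicative G -> H}) : f 1 = 1.
Proof. by apply: (mulgI (f 1)); rewrite -gmulfM !mulg1. Qed.

Lemma multiplicativeV (G H : groupType) (f : {multiplicative G -> H}) :
  {morph f : x / x^-1}.
Proof.
by move=> x; apply/divg1_eq; rewrite invgK -gmulfM mulVg multiplicative1.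
Qed.

Lemma multiplicativeJ (G H : groupType) (f : {multiplicative G -> H}) :
  {morph f : x y / x ^ y}.
Proof. by move=> x y; rewrite !gmulfM multiplicativeV. Qed.

Lemma multiplicativeX (G H : groupType) (f : {multiplicative G -> H}) n :
  {morph f : x / x ^+ n}.
Proof.
by elim: n => [|n IH] x; rewrite ?multiplicative1 // !expgS gmulfM IH.
Qed.

Lemma free_group_ext (X : choiceType) (G : groupType)
    (f g : {multiplicative free_group X -> G}) :
  (forall x, f (fg_gen x) = g (fg_gen x)) -> f =1 g.
Proof.
move=> fg w; suff /seteqP[_ /(_ w I)] : [set w | f w = g w] = setT by [].
apply: free_group_ind => //; split=> [|u v /= fu fv|u /= fu].
- by rewrite /= !multiplicative1.
- by rewrite !gmulfM fu fv.
- by rewrite !multiplicativeV fu.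
Qed.

Lemma normal_closure_normal (G : groupType) (A : set G) :
  is_normal_subgroup (normal_closure A).
Proof.
split; first split.
- by move=> N [[[]]].
- move=> a b Na Nb N [nN AN]; case: (nN) => -[_ NM _] _.
  by apply: NM; [exact: Na|exact: Nb].
- by move=> a Na N [nN AN]; case: (nN) => -[_ _ NV] _; apply: NV; exact: Na.
- by move=> g a Na N [nN AN]; case: (nN) => _; apply; exact: Na.
Qed.

Lemma sub_normal_closure (G : groupType) (A : set G) : A `<=` normal_closure A.
Proof. by move=> a Aa N [_]; apply. Qed.

Lemma normal_closure_sub (G : groupType) (A N : set G) :
  is_normal_subgroup N -> A `<=` N -> normal_closure A `<=` N.
Proof. by move=> nN AN a; apply. Qed.

Lemma kernel_normal (G H : groupType) (f : {multiplicative G -> H}) :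
  is_normal_subgroup (f @^-1` [set 1]).
Proof.
split; first split.
- exact: multiplicative1.
- by move=> a b /= fa fb; rewrite gmulfM fa fb mulg1.
- by move=> a /= fa; rewrite multiplicativeV fa invg1.
- by move=> g a /= fa; rewrite multiplicativeJ fa conj1g.
Qed.

(** * Reidemeister-Schreier rewriting *)

(* Functions [G -> E] twisted by right translations, i.e. the regular wreath
   product with base group [G -> E]. *)
Definition wreath (E G : Type) : Type := ((G -> E) * G)%type.

HB.instance Definition _ (E G : Type) := gen_eqMixin (wreath E G).
HB.instance Definition _ (E G : Type) := gen_choiceMixin (wreath E G).

Section Wreath.
Variables E G : groupType.

Definition wreath_one : wreath E G := (fun=> 1, 1).
Definition wreath_mul (u v : wreath E G) : wreath E G :=
  (fun a => u.1 a * v.1 (a * u.2), u.2 * v.2).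
Definition wreath_inv (u : wreath E G) : wreath E G :=
  (fun a => (u.1 (a * u.2^-1))^-1, u.2^-1).

Lemma wreath_mulA : associative wreath_mul.
Proof.
move=> u v w; congr pair; last exact: mulgA.
by apply/funext => a /=; rewrite !mulgA.
Qed.

Lemma wreath_mul1 : left_id wreath_one wreath_mul.
Proof.
move=> [u a]; congr pair; last exact: mul1g.
by apply/funext => b /=; rewrite mul1g mulg1.
Qed.

Lemma wreath_mulr1 : right_id wreath_one wreath_mul.
Proof.
move=> [u a]; congr pair; last exact: mulg1.
by apply/funext => b /=; rewrite mulg1.
Qed.

Lemma wreath_mulV : left_inverse wreath_one wreath_inv wreath_mul.
Proof.
move=> [u a]; congr pair; last exact: mulVg.
by apply/funext => b /=; rewrite mulVg.
Qed.

Lemma wreath_mulrV : right_inverse wreath_one wreath_inv wreath_mul.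
Proof.
move=> [u a]; congr pair; last exact: mulgV.
by apply/funext => b /=; rewrite mulgK mulgV.
Qed.

HB.instance Definition _ := isGroup.Build (wreath E G)
  wreath_mulA wreath_mul1 wreath_mulr1 wreath_mulV wreath_mulrV.

End Wreath.

Section Rewriting.
Variables (X Q : finType) (G : groupType).
Variables (pi : {multiplicative free_group X -> G}) (c : G -> Q).

(* [rewriting a w] spells, in the generators
   (coset, letter), the path labelled [w] that starts at the coset [c a]. *)
Definition rewriting_wreath (w : free_group X) :
    wreath (free_group (Q * X)%type) G :=
  fg_eval (fun x => (fun a => fg_gen (c a, x), pi (fg_gen x))
    : wreath (free_group (Q * X)%type) G) w.

Definition rewriting (a : G) (w : free_group X) : free_group (Q * X)%type :=
  (rewriting_wreath w).1 a.

Lemma rewriting_wreath2 w : (rewriting_wreath w).2 = pi w.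
Proof.
suff /seteqP[_ /(_ w I)] : [set w | (rewriting_wreath w).2 = pi w] = setT by [].
apply: free_group_ind => [|x]; last by rewrite /= mulg1.
split=> [|u v /= pu pv|u /= pu].
- by rewrite /= /rewriting_wreath !multiplicative1.
- by rewrite gmulfM -pu -pv /rewriting_wreath fg_evalM.
- by rewrite multiplicativeV -pu /rewriting_wreath multiplicativeV.
Qed.

Lemma rewriting1 a : rewriting a 1 = 1.
Proof. by rewrite /rewriting /rewriting_wreath multiplicative1. Qed.

(** This is the first component of the wreath product: having read [u] from [a], the path continues
    from [a * pi u]. *)
Lemma rewritingM a u v :
  rewriting a (u * v) = rewriting a u * rewriting (a * pi u) v.
Proof. by rewrite -rewriting_wreath2 /rewriting /rewriting_wreath fg_evalM. Qed.

Lemma rewritingV a w : rewriting a w^-1 = (rewriting (a * (pi w)^-1) w)^-1.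
Proof. by rewrite -rewriting_wreath2 /rewriting /rewriting_wreath multiplicativeV. Qed.

Lemma rewriting_gen a x : rewriting a (fg_gen x) = fg_gen (c a, x).
Proof. by rewrite /rewriting /rewriting_wreath fg_eval_gen. Qed.

Hypothesis c_mulr : forall a b g, c a = c b -> c (a * g) = c (b * g).

Lemma eq_rewriting a b w : c a = c b -> rewriting a w = rewriting b w.
Proof.
suff /seteqP[_ /(_ w I)] :
  [set w | forall a b, c a = c b -> rewriting a w = rewriting b w] = setT.
  exact.
apply: free_group_ind => [|x /= {}a {}b cab]; last by rewrite !rewriting_gen cab.
split=> [{}a {}b|u v /= pu pv {}a {}b ab|u /= pu {}a {}b ab].
- by rewrite !rewriting1.
- by rewrite !rewritingM (pu _ _ ab) (pv _ _ (c_mulr _ ab)).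
- by rewrite !rewritingV (pu _ _ (c_mulr _ ab)).
Qed.

(** A word fixing the coset [c a] labels a closed path, and its powers run around that path
    repeatedly. This is how rewritten relators remain powers. *)
Lemma rewritingX a v m : c (a * pi v) = c a ->
  rewriting a (v ^+ m) = rewriting a v ^+ m.
Proof.
move=> cav; elim: m => [|m IH]; first by rewrite !expg0 rewriting1.
by rewrite !expgS rewritingM (eq_rewriting _ cav) IH.
Qed.

(** Expand the rewriting of [v * r = r * v] in both ways; [r] leads back to its starting point.
    Hence the rewritings of [r] along an orbit of [v] are conjugate. *)
Lemma rewriting_conj a v r : commute v r -> pi r = 1 ->
  rewriting (a * pi v) r = rewriting a r ^ rewriting a v.
Proof.
move=> vr pr; apply: (mulgI (rewriting a v)).
by rewrite -conjgC -rewritingM vr rewritingM pr mulg1.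
Qed.

Variable t : Q -> free_group X.
Hypotheses (tK : forall q, c (pi (t q)) = q) (t1 : t (c 1) = 1).

(** Each letter goes to its Schreier generator relative to the transversal [t]. *)
Definition unrewriting (e : free_group (Q * X)%type) : free_group X :=
  fg_eval (fun y => t y.1 * fg_gen y.2 *
    (t (c (pi (t y.1) * pi (fg_gen y.2))))^-1) e.


HB.instance Definition _ := isMultiplicative.Build _ _ unrewriting
  (@fg_evalM _ _ _).

Lemma unrewriting1 : unrewriting 1 = 1.
Proof. exact: multiplicative1. Qed.

Lemma unrewritingM : {morph unrewriting : u v / u * v}.
Proof. exact: fg_evalM. Qed.

Lemma unrewritingV : {morph unrewriting : u / u^-1}.
Proof. exact: multiplicativeV. Qed.

(** The product of Schreier generators along a path telescopes, leaving only the representatives of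
    its two ends. *)
Lemma unrewriting_rewriting a w :
  unrewriting (rewriting a w) = t (c a) * w * (t (c (a * pi w)))^-1.
Proof.
suff /seteqP[_ /(_ w I)] : [set w | forall a, unrewriting (rewriting a w) =
  t (c a) * w * (t (c (a * pi w)))^-1] = setT by exact.
apply: free_group_ind => [|x /= {}a]; last first.
  rewrite rewriting_gen /unrewriting fg_eval_gen /=.
  by rewrite (c_mulr _ (tK (c a))).
split=> [{}a|u v /= pu pv {}a|u /= pu {}a].
- by rewrite rewriting1 unrewriting1 multiplicative1 !mulg1 mulgV.
- rewrite rewritingM unrewritingM pu pv gmulfM.
  by rewrite !mulgA mulgVK.
- rewrite rewritingV unrewritingV pu.
  by rewrite !invgM invgK multiplicativeV mulgVK !mulgA.
Qed.

(** Rewriting the Schreier generator of [(q, x)] gives that letter, flanked by the rewriting of one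
    representative and the inverse of that of another; both lie in [M]. So the two maps are inverse
    modulo [M] on this side. *)
Lemma rewriting_unrewriting (M : set (free_group (Q * X)%type)) e :
  is_normal_subgroup M -> (forall q, M (rewriting 1 (t q))) ->
  c (pi (unrewriting e)) = c 1 /\ M (rewriting 1 (unrewriting e) / e).
Proof.
move=> [[M1 MM MV] MJ] Mt.
suff /seteqP[_ /(_ e I)] : [set e | c (pi (unrewriting e)) = c 1 /\
  M (rewriting 1 (unrewriting e) / e)] = setT by [].
apply: free_group_ind => [|[q x] /=]; last first.
  rewrite /unrewriting fg_eval_gen /=.
  set b := pi (t q) * _; have cb : c (b * (pi (t (c b)))^-1) = c 1.
    by rewrite -[in c 1](mulgV (pi (t (c b)))); apply: c_mulr; rewrite tK.
  rewrite !gmulfM multiplicativeV -/b; split=> //.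
  rewrite !rewritingM !mul1g gmulfM -/b rewritingV (eq_rewriting _ cb).
  rewrite rewriting_gen tK -!mulgA; apply: MM; first exact: Mt.
  by have := MJ (fg_gen (q, x))^-1 _ (MV _ (Mt (c b))); rewrite /conjg invgK.
split=> [|u v /= [cu Mu] [cv Mv]|u /= [cu Mu]].
- by rewrite /= unrewriting1 multiplicative1 rewriting1 mulgV.
- rewrite unrewritingM gmulfM; split.
    by rewrite (c_mulr _ cu) mul1g.
  rewrite rewritingM mul1g (eq_rewriting _ cu) invgM.
  have := MM _ _ Mu (MJ u^-1 _ Mv).
  by rewrite /conjg invgK !mulgA mulgVK.
- have cV : c (pi (unrewriting u))^-1 = c 1.
    by rewrite -[X in c X]mul1g -(c_mulr _ cu) mulgV.
  rewrite unrewritingV multiplicativeV.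
  split=> //; rewrite rewritingV mul1g (eq_rewriting _ cV) invgK.
  by have := MJ u _ (MV _ Mu); rewrite /conjg invgM invgK !mulgA mulVg mul1g.
Qed.

Variable A : set (free_group X).
Hypothesis kerpi : pi @^-1` [set 1] = normal_closure A.

(** Modulo [M], [e] is the rewriting of [unrewriting e], a word in the normal closure of [A]. It
    remains to see that all of this closure is rewritten into [M]. *)
Lemma unrewriting_kernel (M : set (free_group (Q * X)%type)) e :
    is_normal_subgroup M -> (forall q, M (rewriting 1 (t q))) ->
    (forall r a, A r -> M (rewriting a r)) ->
  pi (unrewriting e) = 1 -> M e.
Proof.
move=> nM Mt MA pe; have [_ Me] := rewriting_unrewriting e nM Mt.
case: nM => -[M1 MM MV] MJ.
suff /(_ 1) Mu : forall a, M (rewriting a (unrewriting e)).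
  by have := MM _ _ (MV _ Me) Mu; rewrite invgM invgK mulgVK.
(* Conjugation moves the base point, so [N] is normal only because all base points [a] are taken at
   once. *)
pose N := [set w | pi w = 1 /\ forall a, M (rewriting a w)].
suff AN : normal_closure A `<=` N.
  by have /AN[] : normal_closure A (unrewriting e) by rewrite -kerpi.
apply: normal_closure_sub; last first.
  move=> r Ar; split=> [|a]; last exact: MA.
  by have := sub_normal_closure Ar; rewrite -kerpi.
split; first split.
- by split=> [|a]; rewrite ?multiplicative1 ?rewriting1.
- move=> u v [pu Mu] [pv Mv]; split=> [|a]; first by rewrite gmulfM pu pv mulg1.
  by rewrite rewritingM; apply: MM.
- move=> u [pu Mu]; split=> [|a]; first by rewrite multiplicativeV pu invg1.
  by rewrite rewritingV; apply: MV.
- move=> g u [pu Mu]; split=> [|a]; first by rewrite multiplicativeJ pu conj1g.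
  rewrite /conjg !rewritingM pu mulg1 rewritingV multiplicativeV.
  by apply/MJ/Mu.
Qed.

Hypothesis pi_surj : set_surj setT setT pi.

(** [B] only has to generate the rewritten relators as a normal subgroup, which leaves room to keep
    one relator per orbit. *)
Lemma rewriting_presentation (S : {pred G}) (D : subGroupType S)
    (B : set (free_group (Q * X)%type)) :
    (forall a b, c a = c b <-> a / b \in S) ->
    B `<=` [set e | pi (unrewriting e) = 1] ->
    (forall M, is_normal_subgroup M -> B `<=` M ->
      (forall q, M (rewriting 1 (t q))) /\
      (forall r a, A r -> M (rewriting a r))) ->
  is_presentation B D.
Proof.
move=> cP Bker BM.
(* With [M] the whole group, the side conditions of [rewriting_unrewriting] are trivial and its
   first half remains. *)
have uS e : pi (unrewriting e) \in S.
  rewrite -[pi _]divg1; apply/cP.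
  by have [] := @rewriting_unrewriting setT e.
pose f : {multiplicative free_group (Q * X)%type -> D} :=
  fg_eval (fun y => insubd (1 : D) (pi (unrewriting (fg_gen y)))).
have fE e : val (f e) = pi (unrewriting e).
  apply: (@free_group_ext _ _ (val \o f) (pi \o unrewriting)) => y.
  by rewrite /= fg_eval_gen insubdK.
exists f; split.
  move=> d _; have [w _ pw] := pi_surj (I : setT (val d)).
  exists (rewriting 1 w) => //; apply: val_inj; rewrite fE.
  have cd : c (val d) = c 1 by apply/cP; rewrite divg1; exact: valP.
  by rewrite unrewriting_rewriting mul1g pw cd t1 invg1 mulg1 mul1g.
apply/seteqP; split=> e /=.
  move=> fe; have pe : pi (unrewriting e) = 1 by rewrite -fE (_ : f e = 1) // gmulf1.
  have [Mt MA] := BM _ (normal_closure_normal B) (@sub_normal_closure _ B).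
  exact: (unrewriting_kernel (normal_closure_normal B) Mt MA pe).
move=> Be; apply: val_inj; rewrite fE gmulf1.
have nK := kernel_normal (pi \o unrewriting).
exact: (normal_closure_sub nK Bker).
Qed.

End Rewriting.

(** * Sums of weights *)

Section ESum.
Local Open Scope ring_scope.
Local Open Scope ereal_scope.

(** A section [g] of [e] turns a finite subset of the image into one of [P] with the same sum. *)
Lemma le_esum_image (R : realType) (T U : choiceType) (P : set T) (e : T -> U)
    (a : U -> \bar R) :
  \esum_(j in e @` P) a j <= \esum_(i in P) a (e i).
Proof.
have [->|/set0P[i0 Pi0]] := eqVneq P set0.
  by rewrite image_set0 !esum_set0.
pose g j := xget i0 [set i | P i /\ e i = j].
have gP j : (e @` P) j -> P (g j) /\ e (g j) = j.
  by move=> [i Pi <-]; rewrite /g; case: xgetP => [k _ //|/(_ i)[]].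
apply: ge_ereal_sup => _ /= [F [finF FP] <-].
apply: esum_ge; exists (g @` F).
  split; first exact: finite_image.
  by move=> _ [j Fj <-]; have [] := gP _ (FP _ Fj).
rewrite fsbig_image; last first.
  move=> i j /[!inE] Fi Fj gij.
  by have [_ <-] := gP _ (FP _ Fi); have [_ <-] := gP _ (FP _ Fj); rewrite gij.
rewrite le_eqVlt; apply/orP; left; apply/eqP; apply: eq_fsbigr => j /[!inE] Fj.
by have [_ ->] := gP _ (FP _ Fj).
Qed.

Lemma le_esumU (R : realType) (T : choiceType) (A B : set T) (a : T -> \bar R) :
  (forall i, 0 <= a i) ->
  \esum_(i in A `|` B) a i <= \esum_(i in A) a i + \esum_(i in B) a i.
Proof.
move=> a0; rewrite (esumID A) // setUK leeD2l //.
apply: ge_ereal_sup => _ /= [F [finF FP] <-].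
by apply: esum_ge; exists F => //; split=> // i /FP [] [].
Qed.

Lemma esum_le_card (R : realType) (T : finType) (P : pred T) (a : T -> \bar R)
    (M : R) :
  (forall i, P i -> 0 <= a i <= M%:E) ->
  \esum_(i in [set` P]) a i <= (#|P|%:R * M)%:E.
Proof.
move=> aM; rewrite esum_fset; last 2 first.
- exact: finite_finset.
- by move=> i /[!inE] Pi; case/andP: (aM i Pi).
have -> : [set` P] = [set` enum P].
  by apply/seteqP; split=> i /=; rewrite mem_enum.
rewrite -fsbig_seq ?enum_uniq // big_enum.
apply: (@le_trans _ _ (\sum_(i in P) M%:E)).
  by apply: lee_sum => i Pi; case/andP: (aM i Pi).
by rewrite sumEFin sumr_const mulr_natl.
Qed.

Lemma esumZl_nat (R : realType) (T : choiceType) (A : set T) (a : T -> \bar R) n :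
  (forall i, 0 <= a i) ->
  \esum_(i in A) (n%:R%:E * a i) = n%:R%:E * \esum_(i in A) a i.
Proof.
move=> a0; elim: n => [|n IH].
  by rewrite mul0e esum1 // => i _; rewrite mul0e.
have nS x : 0 <= x -> n.+1%:R%:E * x = n%:R%:E * x + x :> \bar R.
  by move=> x0; rewrite -natr1 EFinD ge0_muleDl ?lee_fin // mul1e.
rewrite nS ?esum_ge0 // -IH -esumD //; last first.
  by move=> i _; rewrite mule_ge0 ?lee_fin.
by apply: eq_esum => i _; rewrite nS.
Qed.

End ESum.

(** * Counting orbits *)

Lemma iter_eq_dvdn (T : finType) (f : T -> T) x i : injective f ->
  (iter i f x == x) = (fingraph.order f x %| i)%N.
Proof.
move=> injf; set o := fingraph.order f x.
have iter_o m : iter (m * o) f x = x.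
  by elim: m => // m IH; rewrite mulSn iterD IH iter_order.
rewrite {1}(divn_eq i o) addnC iterD iter_o; apply/eqP/idP => [ix|/eqP -> //].
have := findex_iter (ltn_pmod i (fingraph.order_gt0 f x)).
by rewrite -/o ix findex0 => /esym/eqP.
Qed.

(** The second hypothesis forces every cycle of [f] to have length exactly [d], and the cycles
    partition [T]. *)
Lemma fcard_uniform_order (T : finType) (f : T -> T) d : injective f ->
  (forall x i, (iter i f x == x) = (d %| i)%N) -> (#|froots f| * d)%N = #|T|.
Proof.
move=> injf fd; rewrite -(@fcard_order_set _ f injf d T) //.
  by congr (_ * _)%N; apply: eq_card => x; rewrite !inE andbT.
apply/fintype.subsetP => x _; rewrite inE eqn_dvd.
by rewrite -iter_eq_dvdn // fd dvdnn -(fd x) iter_order //=.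
Qed.

(** * Deficiency of the rewritten presentation *)

Section Deficiency.
Variables (R : realType) (p : nat) (X Q : finType) (G : groupType).
Variables (S : {pred G}) (D : subGroupType S).
Variables (pi : {multiplicative free_group X -> G}) (c : G -> Q).
Variable t : Q -> free_group X.
Hypotheses (p_prime : prime p) (nS : is_normal_subgroup [set` S]).
Hypothesis cP : forall a b, c a = c b <-> a / b \in S.
Hypotheses (tK : forall q, c (pi (t q)) = q) (t1 : t (c 1) = 1).

Lemma coset_mulr a b g : c a = c b -> c (a * g) = c (b * g).
Proof. by move=> /cP ab; apply/cP; rewrite mulgKA. Qed.

(* If [r = v ^+ (p ^ k)] and [v] has order [p ^ l] modulo [S], the rewritten
   relators keep valuation at least [k - l], and only [#|Q| / p ^ l] of them are
   needed, one for each orbit of [v] on the cosets. *)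
Lemma rewriting_relator (r : free_group X) : pi r = 1 ->
  exists J : pred Q,
  (forall M, is_normal_subgroup M ->
    (forall q, J q -> M (rewriting pi c (pi (t q)) r)) ->
    forall a, M (rewriting pi c a r)) /\
  ((\esum_(q in [set` J])
      (relator_weight R p (rewriting pi c (pi (t q)) r))%:E)%R
   <= #|Q|%:R%:E * (relator_weight R p r)%:E)%E.
Proof.
move=> pr; have [v rE] := p_valuationP p r; set k := p_valuation p r in rE.
(* The action of [v] on the cosets. *)
pose rho q := c (pi (t q) * pi v).
have rhoE i a : iter i rho (c a) = c (a * pi v ^+ i).
  elim: i => [|i /= ->]; first by rewrite expg0 mulg1.
  by rewrite expgSr mulgA; apply: coset_mulr; rewrite tK.
have rho_inj : injective rho.
  move=> q q' /(coset_mulr (pi v)^-1); rewrite !mulgK.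
  by rewrite !tK.
pose d := fingraph.order rho (c 1).
have [[S1 SM SV] SJ] := nS.
(* As [S] is normal, a power of [v] fixing one coset fixes all of them, so the orbits of [rho] all
   have length [d]. *)
have rho_d q i : (iter i rho q == q) = (d %| i)%N.
  rewrite -iter_eq_dvdn // -[q]tK !rhoE mul1g.
  apply/eqP/eqP => /cP gS; apply/cP; move: gS; rewrite ?divg1.
    by move=> /(SJ (pi (t q))); rewrite /conjg /= -!mulgA mulVg mulg1 mulKg.
  by move=> /(SJ (pi (t q))^-1); rewrite /conjg /= invgK mulgA.
(* [v ^+ (p ^ k)] is [r], which acts trivially. *)
have : (d %| p ^ k)%N.
  rewrite -iter_eq_dvdn // rhoE -multiplicativeX -rE pr mulg1 //.
case/(dvdn_pfactor _ _ p_prime) => l lk dE.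
have cardJ : (#|froots rho| * p ^ l)%N = #|Q|.
  by rewrite -dE; apply: fcard_uniform_order.
exists (froots rho); split.
  move=> M [[M1 MM MV] MJ] MF a.
  have step q i : M (rewriting pi c (pi (t q)) r) ->
      M (rewriting pi c (pi (t (iter i rho q))) r).
    move=> Mq; elim: i => //= i IH.
    rewrite (@eq_rewriting _ _ _ pi _ coset_mulr _ (pi (t (iter i rho q)) * pi v)).
      rewrite rewriting_conj //; first exact: MJ.
      rewrite rE; elim: (p ^ k)%N => [|m IHm]; first exact: commute1.
      by rewrite expgS; exact: commuteM.
    by rewrite tK.
  rewrite (@eq_rewriting _ _ _ pi _ coset_mulr _ (pi (t (c a)))) ?tK //.
  have /iter_findex <- : fconnect rho (froot rho (c a)) (c a).
    by rewrite fconnect_sym // connect_root.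
  apply/step/MF; apply: roots_root; exact: fconnect_sym.
(* The trivial relator has weight 0 and not [p ^- k], but so do its rewritings. *)
have [->|r1] := eqVneq r 1.
  rewrite esum1 => [|q _]; last by rewrite rewriting1 /relator_weight eqxx.
  by rewrite /relator_weight eqxx mule0.
apply: (@le_trans _ _ (#|froots rho|%:R * p%:R ^- (k - l))%:E%R).
  apply: esum_le_card => q _; rewrite !lee_fin relator_weight_ge0 /=.
  apply: relator_weight_le; first exact: prime_gt1.
  (* [v ^+ (p ^ l)] fixes every coset, so the rewriting of [r] is the [p ^ (k - l)]-th power of this
     word. *)
  exists (rewriting pi c (pi (t q)) (v ^+ (p ^ l))); rewrite -rewritingX.
  - by rewrite -expgnA -expnD subnKC // -rE.
  - exact: coset_mulr.
  - by rewrite multiplicativeX -rhoE tK; apply/eqP; rewrite rho_d dE.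
rewrite /relator_weight (negPf r1) -/k -EFinM lee_fin -cardJ natrM -mulrA.
rewrite natrX -[in leRHS](subnKC lk) exprD invfM mulrA (mulrA _ _ (_ ^-1))%R.
by rewrite mulfK // expf_neq0 // pnatr_eq0 -lt0n prime_gt0.
Qed.

Lemma deficiency_rewriting (A : set (free_group X)) :
    set_surj setT setT pi -> pi @^-1` [set 1] = normal_closure A ->
  (#|Q|%:R%:E * presentation_deficiency R p A <= p_deficiency R p D)%E.
Proof.
move=> pi_surj kerpi.
have /choice[J JP] : forall r, exists J : pred Q, pi r = 1 ->
  (forall M, is_normal_subgroup M ->
    (forall q, J q -> M (rewriting pi c (pi (t q)) r)) ->
    forall a, M (rewriting pi c a r)) /\
  ((\esum_(q in [set` J])
      (relator_weight R p (rewriting pi c (pi (t q)) r))%:E)%R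
   <= #|Q|%:R%:E * (relator_weight R p r)%:E)%E.
  move=> r; have [pr|npr] := eqVneq (pi r) 1; last first.
    by exists xpredT => pr; rewrite pr eqxx in npr.
  by have [J JP] := rewriting_relator pr; exists J.
have piA r : A r -> pi r = 1.
  by move=> Ar; have := sub_normal_closure Ar; rewrite -kerpi.
(* The representative of [c 1] is trivial and so is its rewriting: only [#|Q| - 1] relators come
   from representatives. *)
pose T0 := [set` [pred q | q != c 1]].
pose rel k := rewriting pi c (pi (t k.2)) k.1.
pose B := (fun q => rewriting pi c 1 (t q)) @` T0 `|`
  rel @` (A `*`` (fun r => [set` J r])).
have presB : is_presentation B D.
  apply: (@rewriting_presentation _ _ _ _ _ coset_mulr _ tK t1 _ kerpi pi_surj _ _ _ cP).
    move=> _ [[q _ <-]|[[r q] [/= Ar _] <-]] /=; rewrite unrewriting_rewriting //=.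
    - by rewrite t1 !mul1g tK mulgV multiplicative1.
    - exact: coset_mulr.
    - by rewrite !gmulfM multiplicativeV (piA r Ar) !mulg1 mulgV.
    - exact: coset_mulr.
  move=> M nM BM; split=> [q|r a Ar].
    have [->|qc] := eqVneq q (c 1); last by apply: BM; left; exists q.
    by rewrite t1 rewriting1; case: nM => -[].
  have [JM _] := JP r (piA r Ar); apply: JM => // q Jq.
  by apply: BM; right; exists (r, q).
apply: (@le_trans _ _ (presentation_deficiency R p B)); last first.
  by apply: ereal_sup_ubound; exists (Q * X)%type, B.
rewrite /presentation_deficiency.
set w := fun r => _; set wB := (\esum_(r in B) _)%R; set s := (\esum_(r in A) _)%R.
have Q0 : (0 < #|Q|)%N by apply/card_gt0P; exists (c 1).
have s0 : (0 <= s)%E by apply: esum_ge0 => r _; rewrite lee_fin relator_weight_ge0.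
have wBs : (wB <= (#|Q|%:R - 1)%:E + #|Q|%:R%:E * s)%E.
  apply: le_trans (le_esumU _ _ _) _.
    by move=> r; rewrite lee_fin relator_weight_ge0.
  apply: leeD.
    apply: le_trans (le_esum_image _ _ _) _.
    apply: le_trans (@esum_le_card _ _ _ _ 1 _) _.
      move=> q _; rewrite !lee_fin relator_weight_ge0 /=.
      have := @relator_weight_le R _ p (rewriting pi c 1 (t q)) 0 (prime_gt1 p_prime).
      rewrite expr0 invr1; apply; by exists (rewriting pi c 1 (t q)).
    rewrite mulr1 lee_fin lerBrDr natr1 ler_nat.
    by rewrite (cardC1 (c 1)) prednK.
  apply: le_trans (le_esum_image _ _ _) _.
  rewrite -(@esum_esum _ _ _ _ (fun r => [set` J r])
    (fun r q => (relator_weight R p (rewriting pi c (pi (t q)) r))%:E)); last first.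
    by move=> r q _ _; rewrite lee_fin relator_weight_ge0.
  rewrite -esumZl_nat => [|r]; last by rewrite lee_fin relator_weight_ge0.
  by apply: le_esum => r Ar; have [_] := JP r (piA r Ar).
(* If the weights of [A] diverge, the left-hand side is [-oo] because [#|Q|] is positive. *)
case: s s0 wBs => [s||] //= s0 wBs; last first.
  by rewrite mulrNy gtr0_sg ?mul1e ?leNye // ltr0n.
apply: le_trans (leeB (lexx _) wBs).
rewrite -!EFinM -!EFinD lee_fin card_prod natrM; lra.
Qed.

End Deficiency.

(** For normal [N] left and right cosets agree; the form [a / b] suits the action of letters by
    right multiplication. *)
Lemma eq_left_coset (G : groupType) (N : set G) a b : is_normal_subgroup N ->
  left_coset N a = left_coset N b <-> N (a / b).
Proof.
move=> [[N1 NM NV] NJ]; split=> [ab|].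
  have : left_coset N a a by exists 1; rewrite ?mulg1.
  by rewrite ab => -[x Nx <-]; rewrite -[b in b * x]invgK -mulgA; exact: NJ.
have sub g h : N (g / h) -> left_coset N g `<=` left_coset N h.
  move=> Ngh _ [x Nx <-]; exists ((g / h) ^ h * x); last first.
    by rewrite /conjg !mulgA mulgV mul1g mulgVK.
  by apply: NM => //; apply: NJ.
move=> Nab; apply/seteqP; split; apply: sub => //.
by have := NV _ Nab; rewrite invgM invgK.
Qed.

Lemma group_index_gt0 (G : groupType) (N : set G) :
  finite_index N -> (0 < group_index N)%N.
Proof.
move=> finN; rewrite /group_index cardfs_gt0; apply/fset0Pn.
by exists (left_coset N 1); rewrite in_fset_set // inE; exists 1.
Qed.

Lemma p_deficiency_index (R : realType) (p : nat) (G : groupType)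
    (S : {pred G}) (D : subGroupType S) :
  prime p -> is_normal_subgroup [set` S] -> finite_index [set` S] ->
  ((group_index [set` S])%:R%:E * p_deficiency R p G <= p_deficiency R p D)%E.
Proof.
move=> p_prime nS finS; set N := [set` S] in nS finS *.
pose Q := fset_set (left_cosets N) : finType.
have cQ a : left_coset N a \in fset_set (left_cosets N).
  by rewrite in_fset_set // inE; exists a.
pose c a : Q := FSetSub (cQ a).
have cP a b : c a = c b <-> a / b \in S.
  split=> [/(congr1 val) /= /(eq_left_coset _ _ nS) //|abS].
  by apply: val_inj => /=; apply/(eq_left_coset _ _ nS).
have cardQ : group_index N = #|Q| by rewrite /group_index cardfE.
have Q0 : (0 < #|Q|)%N by rewrite -cardQ group_index_gt0.
(* Dividing by the index isolates the supremum, so that it can be bounded one presentation at a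
   time. *)
rewrite cardQ -lee_pdivlMl ?ltr0n //.
apply: ge_ereal_sup => _ [X [A [[f [f_surj kerf]] ->]]].
rewrite lee_pdivlMl ?ltr0n //.
have /choice[t tK] : forall q : Q, exists w, c (f w) = q.
  move=> q; have := fsvalP q; rewrite in_fset_set // inE => -[g _ gq].
  have [w _ fw] := f_surj g I; exists w; apply: val_inj => /=.
  by rewrite fw.
(* The chosen representatives are corrected so that the trivial coset gets the trivial word. *)
pose t' q := if q == c 1 then 1 else t q.
apply: (@deficiency_rewriting R p X Q G S D f c t') => //.
- by move=> q; rewrite /t'; case: eqP => // ->; rewrite multiplicative1.
- by rewrite /t' eqxx.
Qed.

(** * Pro-p completions *)

Lemma left_coset_kernel (G H : groupType) (f : {multiplicative G -> H}) g :
  left_coset (f @^-1` [set 1]) g = f @^-1` [set f g].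
Proof.
apply/seteqP; split=> [_ [a /= fa <-]|h /= fh]; first by rewrite /= gmulfM fa mulg1.
exists (g^-1 * h); last by rewrite mulVKg.
by rewrite /= gmulfM multiplicativeV fh mulVg.
Qed.

Lemma left_cosets_kernel (G H : groupType) (f : {multiplicative G -> H}) :
  set_surj setT setT f ->
  left_cosets (f @^-1` [set 1]) = range (fun h => f @^-1` [set h]).
Proof.
move=> f_surj; apply/seteqP; split=> [_ [g _ <-]|_ [h _ <-]].
  by exists (f g) => //; rewrite left_coset_kernel.
by have [g _ <-] := f_surj h I; exists g => //; rewrite left_coset_kernel.
Qed.

(** The kernel [N] has index [p]; any [g] outside it defines the thread of its cosets, which is
    non-trivial at [N]. *)
Lemma surj_Fp_nontrivial_pro_p (p : nat) (G : groupType)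
    (f : {multiplicative G -> 'F_p}) :
  prime p -> set_surj setT setT f -> nontrivial (pro_p_completion p G).
Proof.
move=> p_prime f_surj; set N := f @^-1` [set 1].
have finT : finite_set [set: 'F_p] by exact: finite_finset.
have pN : p_power_index p N.
  split; first exact: kernel_normal.
    by rewrite /finite_index left_cosets_kernel //; exact: finite_image.
  exists 1%N; rewrite expn1 /group_index left_cosets_kernel // fset_set_image //.
  rewrite card_imfset /=; last first.
    (* By surjectivity, distinct elements of ['F_p] have distinct fibres, so the cosets are counted
       by ['F_p]. *)
    move=> h k hk; have [g _ fg] := f_surj h I.
    have : (f @^-1` [set h]) g by [].
    by rewrite hk /= fg.
  rewrite -[RHS](card_Fp p_prime) cardE; apply/perm_size/uniq_perm.
  - exact: fset_uniq.
  - exact: enum_uniq.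
  - by move=> i; rewrite mem_enum in_fset_set // mem_set.
(* The ring unit [1%R] is not the neutral element of the group ['F_p], which is [0%R]. *)
have [g _ fg] := f_surj (1%R : 'F_p) I.
have thread_ok (M : p_quotients p G) : left_cosets (sval M) (left_coset (sval M) g).
  by exists g.
have compat (M K : p_quotients p G) :
    sval M `<=` sval K -> left_coset (sval M) g `<=` left_coset (sval K) g.
  by move=> MK _ [a Ma <-]; exists a => //; exact: MK.
exists (@ProP p G _ thread_ok compat) => /(congr1 (fun x => thread x (exist _ N pN))) /=.
rewrite left_coset_kernel => /seteqP[/(_ g erefl) /=].
move=> Ng _; move/eqP: (oner_neq0 'F_p); apply; rewrite -fg; exact: Ng.
Qed.

(** * Linear algebra over ['F_p] *)

Lemma Fp_morphism_surj (p : nat) (G : groupType) (f : {multiplicative G -> 'F_p})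
    g : f g <> 1 -> set_surj setT setT f.
Proof.
move=> fg h _; exists (g ^+ nat_of_ord (h / f g)%R) => //.
rewrite multiplicativeX FinRing.zmodXgE -mulr_natr natr_Zp mulrC divfK //.
exact/eqP.
Qed.

(** The second factor is the exponent sum of [x] in [w], so the value on [w] is linear in [h]. *)
Lemma fg_eval_Fp (p : nat) (X : finType) (h : X -> 'F_p) (w : free_group X) :
  fg_eval h w = (\sum_x h x * fg_eval (fun y => (y == x)%:R : 'F_p) w)%R :> 'F_p.
Proof.
case: w => w rw; rewrite /fg_eval /= {rw}; elim: w => [|[x b] w /= ->].
  by rewrite big1 // => x _; rewrite mulr0.
under [RHS]eq_bigr do rewrite mulrDr.
rewrite [RHS]big_split; congr (_ + _)%R; rewrite (bigD1 x) //= big1.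
  by rewrite addr0; case: b; rewrite /letter_eval /= eqxx ?mulr1 // mulrN1.
move=> y yx; rewrite /letter_eval /= eq_sym (negPf yx); case: b.
  by rewrite mulr0.
by rewrite -[_^-1]/(- _)%R oppr0 mulr0.
Qed.

(** A linear system with [#|X|] unknowns [h x] and fewer equations, one per word; [M] is its matrix
    of exponent sums. *)
Lemma Fp_morphism_killing (p : nat) (X : finType) (s : seq (free_group X)) :
  (size s < #|X|)%N ->
  exists2 h : X -> 'F_p, exists x, h x != 0%R &
    forall r, r \in s -> fg_eval h r = 0%R :> 'F_p.
Proof.
move=> sX.
pose M := (\matrix_(i < #|X|, j < size s)
  fg_eval (fun y => (y == enum_val i)%:R : 'F_p) (nth 1%g s j))%R.
have : kermx M != 0%R.
  rewrite kermx_eq0 /row_free neq_ltn.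
  by rewrite (leq_ltn_trans (rank_leq_col M) sX).
case/rowV0Pn => u /sub_kermxP uM u0.
exists (fun x => u 0%R (enum_rank x)).
  apply: contrapT => /forallNP u_eq0; move/eqP: u0; apply; apply/rowP => i.
  rewrite mxE; have /negP/negPn/eqP := u_eq0 (enum_val i).
  by rewrite enum_valK.
move=> r rs; rewrite fg_eval_Fp.
have rsz : (index r s < size s)%N by rewrite index_mem.
have := congr1 (fun A : 'rV_(size s) => A 0%R (Ordinal rsz)) uM.
rewrite /= !mxE (reindex enum_rank) /=; last first.
  by exists enum_val => i _; rewrite ?enum_rankK ?enum_valK.
by apply: etrans; apply: eq_bigr => x _; rewrite mxE enum_rankK nth_index.
Qed.

(** Each non-trivial relator of valuation 0 weighs exactly 1, so finite sets of them have fewer than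
    [n] elements, and an infinite set would contain larger ones. *)
Lemma weight_lt_valuation0 (R : realType) (p : nat) (X : choiceType)
    (A : set (free_group X)) (n : nat) :
  ((\esum_(r in A) (relator_weight R p r)%:E)%R < n%:R%:E)%E ->
  exists2 s : seq (free_group X), (size s < n)%N &
    forall r, A r -> r != 1 -> p_valuation p r = 0%N -> r \in s.
Proof.
move=> An; pose A0 := [set r | [/\ A r, r != 1 & p_valuation p r = 0%N]].
have small (F : {fset (free_group X)}) : [set` F] `<=` A0 -> (#|` F| < n)%N.
  move=> FA0; rewrite -(ltr_nat R) -lte_fin; apply: le_lt_trans An.
  apply: esum_ge; exists [set` F]; first by split=> // r /FA0[].
  rewrite -fsbig_seq ?fset_uniq // sumEFin lee_fin.
  rewrite (eq_big_seq (fun=> 1%R)) ?big_const_seq ?count_predT ?iter_addr_0 //.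
  move=> r /FA0[_ r1 v0]; rewrite /relator_weight (negPf r1) v0.
  by rewrite expr0 invr1.
have finA0 : finite_set A0.
  apply: contrapT => /(infinite_set_fset n)[F FA0].
  by rewrite leqNgt small.
exists (fset_set A0); first by apply: small; rewrite fset_setK.
by move=> r Ar r1 v0; rewrite in_fset_set // inE.
Qed.

Lemma p_deficiency_gt_nontrivial_pro_p (R : realType) (p : nat) (G : groupType) :
  prime p -> ((-1)%:E < p_deficiency R p G)%E ->
  nontrivial (pro_p_completion p G).
Proof.
move=> p_prime /ereal_sup_gt[_ [X [A [[f [f_surj kerf]] ->]]]].
rewrite /presentation_deficiency => defA.
have /weight_lt_valuation0[s sX sA] :
    ((\esum_(r in A) (relator_weight R p r)%:E)%R < #|X|%:R%:E)%E.
  move: defA; case: (\esum_(r in A) _)%R => [a||] //=; last by rewrite ltNyr.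
  rewrite -EFinD !lte_fin; lra.
have [h [x hx] hs] := Fp_morphism_killing p sX.
have hA : normal_closure A `<=` fg_eval h @^-1` [set 1].
  apply: normal_closure_sub; first exact: kernel_normal.
  (* Non-trivial relators of valuation 0 are in [s]; those of positive valuation are [p]-th powers,
     killed in characteristic [p]. *)
  move=> r Ar /=; have [->|r1] := eqVneq r 1; first exact: multiplicative1.
  case v: (p_valuation p r) => [|k]; first exact/hs/sA.
  have [u ->] := p_valuationP p r; rewrite v multiplicativeX FinRing.zmodXgE.
  by rewrite -mulr_natr natrX pchar_Fp_0 // expr0n mulr0.
(* As [fg_eval h] kills the kernel of [f], it descends to [G] through any section of [f]. *)
have /choice[sec secK] : forall g, exists w, f w = g.
  by move=> g; have [w _ fw] := f_surj g I; exists w.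
have eqf u v : f u = f v -> fg_eval h u = fg_eval h v.
  move=> fuv; apply: divg1_eq; rewrite -multiplicativeV -gmulfM.
  by apply: hA; rewrite -kerf /= gmulfM multiplicativeV fuv mulgV.
pose F : G -> 'F_p := fg_eval h \o sec.
have FM : {morph F : a b / a * b}.
  by move=> a b; rewrite /F /= -gmulfM; apply: eqf; rewrite gmulfM !secK.
pose Fm := HB.pack_for {multiplicative G -> 'F_p} F (isMultiplicative.Build _ _ F FM).
apply: (@surj_Fp_nontrivial_pro_p p G Fm) => //.
apply: (@Fp_morphism_surj _ _ _ (f (fg_gen x))).
rewrite /= /F /= (eqf _ (fg_gen x)) ?secK // fg_eval_gen.
exact/eqP.
Qed.

Local Open Scope ereal_scope.

Theorem mainTheorem1 (R : realType) (p : nat) (p_prime : prime p)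
    (Gamma : groupType) (Gamma_fg : finitely_generated Gamma)
    (S : {pred Gamma}) (Delta : subGroupType S)
    (Delta_normal : is_normal_subgroup [set` S])
    (Delta_finite_index : finite_index [set` S]) :
  (group_index [set` S])%:R%:E * p_deficiency R p Gamma <= p_deficiency R p Delta
  /\ (0 <= p_deficiency R p Gamma ->
        0 <= p_deficiency R p Delta /\ nontrivial (pro_p_completion p Delta))
  /\ (0 < p_deficiency R p Gamma ->
        0 < p_deficiency R p Delta /\ nontrivial (pro_p_completion p Delta)).
Proof.
have le_def := p_deficiency_index R Delta p_prime Delta_normal Delta_finite_index.
(* Non-negative deficiency exceeds the threshold -1. *)
have nt : 0 <= p_deficiency R p Delta -> nontrivial (pro_p_completion p Delta).
  move=> d0; apply: (@p_deficiency_gt_nontrivial_pro_p R) => //.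
  by apply: lt_le_trans d0; rewrite lte_fin ltrN10.
split=> //; split=> d0.
  have dD : 0 <= p_deficiency R p Delta.
    by apply: le_trans le_def; rewrite mule_ge0 // lee_fin.
  by split=> //; exact: nt.
have dD : 0 < p_deficiency R p Delta.
  apply: lt_le_trans le_def.
  by rewrite mule_gt0 // lte_fin ltr0n group_index_gt0.
by split=> //; exact/nt/ltW.
Qed.
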